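(* There exists a mixed substitution system $(F,s)$ whose tiling space $\Omega_{F,s}$ has first Čech cohomology group $\check{H}^1(\Omega_{F,s})$ not isomorphic to any group of the form $$A\oplus\left(\mathbb{Z}\left[\tfrac{1}{n_1}\right]\oplus\cdots\oplus\mathbb{Z}\left[\tfrac{1}{n_k}\right]\right)$$ with $A$ a finitely generated abelian group and $n_1,\dots,n_k$ (positive) natural numbers.
   Context: Let $\mathcal{A}$ be a finite alphabet, and let $\mathcal{A}^*=\bigcup_{n\ge 1}\mathcal{A}^n$ be the set of non-empty finite words. A substitution is a map $\phi\colon\mathcal{A}\to\mathcal{A}^*$, extended to words by concatenation. A mixed substitution system is a pair $(F,s)$, where $F=\{\phi_0,\dots,\phi_k\}$ is a finite set of substitutions on $\mathcal{A}$ and $s=(s_0,s_1,s_2,\dots)\in\{0,\dots,k\}^{\mathbb{N}}$. For $m\le n$ write $\phi_{s[m,n]}=\phi_{s_m}\circ\phi_{s_{m+1}}\circ\cdots\circ\phi_{s_n}$. A bi-infinite sequence $\mathcal{T}=(a_j)_{j\in\mathbb{Z}}\in\mathcal{A}^{\mathbb{Z}}$ is admitted by $(F,s)$ if every finite string $a_t a_{t+1}\cdots a_{t+u}$ ($t\in\mathbb{Z}$, $u\ge 0$) is a subword of $\phi_{s[0,n]}(a)$ for some $n\ge 0$ and some $a\in\mathcal{A}$. The discrete hull $\Sigma_{F,s}\subset\mathcal{A}^{\mathbb{Z}}$ is the set of all admitted sequences (with the subspace topology from the product topology). It is invariant under the left shift $\sigma$. The tiling space is the suspension $\Omega_{F,s}=(\Sigma_{F,s}\times[0,1])/{\sim}$,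 where $(\mathcal{T},1)\sim(\sigma(\mathcal{T}),0)$. Cohomology has integer coefficients. *)

(* Defs.v *)
From HB Require Import structures.
From mathcomp Require Import all_boot all_order all_algebra generic_quotient.
From mathcomp Require Import all_classical all_reals topology normedtype.
From mathcomp Require Import ring.

Set Implicit Arguments.
Unset Strict Implicit.
Unset Printing Implicit Defensive.

Import Order.TTheory GRing.Theory Num.Theory.
Import numFieldNormedType.Exports.
Local Open Scope classical_set_scope.
Local Open Scope ring_scope.
Local Open Scope quotient_scope.

Record substitution (A : eqType) := Substitution {
  subst_letter :> A -> seq A ;
  subst_letter_neq0 : forall a, subst_letter a != [::] }.

Definition subst_word (A : eqType) (phi : substitution A) (w : seq A) : seq A :=
  flatten [seq phi a | a <- w].

(** [F] is given as an indexed family [phi_0, ..., phi_k], so that it is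
    non-empty; [s] is the directive sequence. *)
Record mixed_system (A : eqType) := MixedSystem {
  ms_max : nat ;
  ms_subst : 'I_ms_max.+1 -> substitution A ;
  ms_seq : nat -> 'I_ms_max.+1 }.

(** [phi_{s_m} \o phi_{s_{m+1}} \o ... \o phi_{s_n}] *)
Definition subst_range (A : eqType) (S : mixed_system A) (m n : nat) (w : seq A) :
    seq A :=
  foldr (fun i => subst_word (ms_subst (ms_seq S i))) w (index_iota m n.+1).

Definition factor (A : Type) (x : int -> A) (t : int) (u : nat) : seq A :=
  [seq x (t + i%:Z) | i <- iota 0 u.+1].

Definition admitted (A : eqType) (S : mixed_system A) (x : int -> A) : Prop :=
  forall (t : int) (u : nat), exists (n : nat) (a : A),
    infix (factor x t u) (subst_range S 0 n [:: a]).

Definition full_shift (A : finType) : topologicalType :=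
  {ptws int -> discrete_topology A}.

Definition hull (A : finType) (S : mixed_system A) : set (full_shift A) :=
  [set x : int -> A | admitted S x].

Definition shift (A : Type) (x : int -> A) : int -> A := fun j => x (j + 1).

Section suspension.
Variables (R : realType) (A : finType) (S : mixed_system A).

Definition unit_interval : set R := [set t | 0 <= t <= 1].

Definition cylinder : topologicalType :=
  (set_type (hull S) * set_type unit_interval)%type.

Definition glued (p q : cylinder) : Prop :=
  [/\ set_val p.2 = 1, set_val q.2 = 0 &
      set_val q.1 = shift (set_val p.1) :> (int -> A)].

(** Since [0 <> 1] and the shift is injective, this is already the equivalence
    relation generated by [glued]. *)
Definition suspension_rel (p q : cylinder) : bool :=
  `[< [\/ p = q, glued p q | glued q p] >].

Lemma suspension_rel_refl : reflexive suspension_rel.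
Proof. by move=> p; apply/asboolP; constructor 1. Qed.

Lemma suspension_rel_sym : symmetric suspension_rel.
Proof.
move=> p q; apply/asboolP/asboolP => -[->|h|h];
  by [constructor 1|constructor 2|constructor 3].
Qed.

Lemma glued_injl p p' q : glued p q -> glued p' q -> p = p'.
Proof.
case: p p' => [x s] [x' s'] [/= s1 _ e] [/= s'1 _ e'].
congr pair; apply: val_inj; last by rewrite -!set_valE s1 s'1.
apply/funext => j; move: e; rewrite e' => /(congr1 (fun f => f (j - 1))).
by rewrite /shift subrK => /esym.
Qed.

Lemma glued_injr p q q' : glued p q -> glued p q' -> q = q'.
Proof.
case: q q' => [x s] [x' s'] [/= _ s1 e] [/= _ s'1 e'].
by congr pair; apply: val_inj; rewrite -!set_valE ?s1 ?s'1 ?e ?e'.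
Qed.

Lemma glued_glued p q r : glued p q -> glued q r -> False.
Proof.
move=> [_ q0 _] [q1 _ _].
by have := etrans (esym q1) q0; move/eqP; rewrite oner_eq0.
Qed.

Lemma suspension_rel_trans : transitive suspension_rel.
Proof.
move=> q p r /asboolP pq /asboolP qr; apply/asboolP.
case: pq qr => [->//|pq [<-|qr|rq]|qp [<-|qr|rq]].
- by constructor 2.
- by case: (glued_glued pq qr).
- by constructor 1; apply: glued_injl pq rq.
- by constructor 3.
- by constructor 1; apply: glued_injr qp qr.
- by case: (glued_glued rq qp).
Qed.

Definition suspension_equiv : equiv_rel cylinder :=
  EquivRel suspension_rel
    suspension_rel_refl suspension_rel_sym suspension_rel_trans.

Definition tiling_space : topologicalType :=
  quotient_topology {eq_quot suspension_equiv}.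

End suspension.

(** [cech_H1 X] is the first Cech cohomology group of [X] with integer
    coefficients: the direct limit, over the open covers [U] of [X] ordered by
    refinement, of the groups [H^1(N(U); Z)], where [N(U)] is the nerve of
    [U]. *)

Section cech.
Variable X : topologicalType.

Definition open_cover (U : set (set X)) : Prop :=
  U `<=` open /\ \bigcup_(A in U) A = setT.

(** A 1-cochain of [N(U)] is a function on the ordered pairs of members of
    [U] with non-empty intersection.  It is represented by a total function,
    whose values at other pairs are ignored by [cocycle] and [cohomologous]. *)
Definition cochain0 := set X -> int.
Definition cochain1 := set X -> set X -> int.

Definition cocycle (U : set (set X)) (c : cochain1) : Prop :=
  forall A B C, U A -> U B -> U C -> A `&` B `&` C !=set0 ->
    c B C - c A C + c A B = 0.

Definition cohomologous (U : set (set X)) (c d : cochain1) : Prop :=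
  exists b : cochain0, forall A B, U A -> U B -> A `&` B !=set0 ->
    c A B - d A B = b B - b A.

Definition refines (V U : set (set X)) (p : set X -> set X) : Prop :=
  forall A, V A -> U (p A) /\ A `<=` p A.

Definition pullback (p : set X -> set X) (c : cochain1) : cochain1 :=
  fun A B => c (p A) (p B).

Record cech_cocycle := CechCocycle {
  cc_cover : set (set X) ;
  cc_cochain : cochain1 ;
  cc_open_cover : open_cover cc_cover ;
  cc_cocycle : cocycle cc_cover cc_cochain }.

HB.instance Definition _ := gen_eqMixin cech_cocycle.
HB.instance Definition _ := gen_choiceMixin cech_cocycle.

(** Two cocycles define the same element of the direct limit when they become
    cohomologous on a common refinement of their covers. *)
Definition cech_rel (x y : cech_cocycle) : bool :=
  `[< exists W p q, [/\ open_cover W, refines W (cc_cover x) p,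
        refines W (cc_cover y) q &
        cohomologous W (pullback p (cc_cochain x))
                       (pullback q (cc_cochain y))] >].

Lemma cohomologous_refl U c : cohomologous U c c.
Proof. by exists (fun=> 0) => A B _ _ _; rewrite !subrr. Qed.

Lemma cohomologous_sym U c d : cohomologous U c d -> cohomologous U d c.
Proof.
case=> b hb; exists (fun A => - b A) => A B UA UB AB.
by rewrite -opprB hb // opprB opprK addrC.
Qed.

Lemma cohomologous_trans U c d e :
  cohomologous U c d -> cohomologous U d e -> cohomologous U c e.
Proof.
move=> [b hb] [b' hb']; exists (fun A => b A + b' A) => A B UA UB AB.
rewrite -(subrKA (d A B)) hb // hb' // opprD.
by rewrite addrACA.
Qed.

Lemma cohomologousD U c d c' d' : cohomologous U c d -> cohomologous U c' d' ->
  cohomologous U (fun A B => c A B + c' A B) (fun A B => d A B + d' A B).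
Proof.
move=> [b hb] [b' hb']; exists (fun A => b A + b' A) => A B UA UB AB.
by rewrite !opprD addrACA hb // hb' // addrACA.
Qed.

Lemma cohomologousN U c d : cohomologous U c d ->
  cohomologous U (fun A B => - c A B) (fun A B => - d A B).
Proof.
move=> [b hb]; exists (fun A => - b A) => A B UA UB AB.
by rewrite -!opprD hb // opprB opprK addrC.
Qed.

Lemma refines_id U : refines U U id.
Proof. by move=> A UA; split. Qed.

Lemma refines_comp W V U p q :
  refines W V q -> refines V U p -> refines W U (p \o q).
Proof.
by move=> hq hp A /hq[/hp[Up Ap] Aq]; split=> //; apply: subset_trans Ap.
Qed.

Lemma subset_nonempty (A B : set X) : A `<=` B -> A !=set0 -> B !=set0.
Proof. by move=> AB [x /AB]; exists x. Qed.

Lemma cocycle_pullback V U p c :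
  refines V U p -> cocycle U c -> cocycle V (pullback p c).
Proof.
move=> hp hc A B C /hp[UA sA] /hp[UB sB] /hp[UC sC] ABC; apply: hc => //.
by apply: subset_nonempty ABC => x [[/sA ? /sB ?] /sC].
Qed.

Lemma cohomologous_pullback V U p c d : refines V U p ->
  cohomologous U c d -> cohomologous V (pullback p c) (pullback p d).
Proof.
move=> hp [b hb]; exists (b \o p) => A B /hp[UA sA] /hp[UB sB] AB.
by apply: hb => //; apply: subset_nonempty AB => x [/sA ? /sB].
Qed.

Lemma pullback_indep V U p q c : refines V U p -> refines V U q ->
  cocycle U c -> cohomologous V (pullback p c) (pullback q c).
Proof.
move=> hp hq hc; exists (fun A => - c (p A) (q A)) => A B VA VB [x [Ax Bx]].
have [UpA /(_ x Ax) pAx] := hp _ VA; have [UpB /(_ x Bx) pBx] := hp _ VB.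
have [UqA /(_ x Ax) qAx] := hq _ VA; have [UqB /(_ x Bx) qBx] := hq _ VB.
have e1 : c (p B) (q B) - c (p A) (q B) + c (p A) (p B) = 0.
  by apply: hc => //; exists x.
have e2 : c (q A) (q B) - c (p A) (q B) + c (p A) (q A) = 0.
  by apply: hc => //; exists x.
rewrite /pullback -[LHS]addr0 -{1}e2 -[RHS]addr0 -[in RHS]e1; ring.
Qed.

Definition cover_meet (U V : set (set X)) : set (set X) :=
  [set C | exists A B, [/\ U A, V B & C = A `&` B]].

Lemma cover_meet_open U V :
  open_cover U -> open_cover V -> open_cover (cover_meet U V).
Proof.
move=> [oU cU] [oV cV]; split.
  by move=> _ [A [B [/oU oA /oV oB ->]]]; exact: openI.
rewrite -subTset => x _.
have [A UA Ax] : (\bigcup_(A in U) A) x by rewrite cU.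
have [B VB Bx] : (\bigcup_(B in V) B) x by rewrite cV.
by exists (A `&` B) => //; exists A, B.
Qed.

Lemma cover_meet_refines U V : exists pq : (set X -> set X) * (set X -> set X),
  refines (cover_meet U V) U pq.1 /\ refines (cover_meet U V) V pq.2.
Proof.
have /choice[f hf] (C : set X) : exists AB : set X * set X,
    cover_meet U V C -> [/\ U AB.1, V AB.2 & C = AB.1 `&` AB.2].
  have [[A [B h]]|h] := pselect (cover_meet U V C); first by exists (A, B).
  by exists (C, C).
exists (fst \o f, snd \o f).
by split=> C /hf[UA VB {2}->]; split=> // x [].
Qed.

Definition meet1 U V : set X -> set X :=
  (sval (cid (cover_meet_refines U V))).1.
Definition meet2 U V : set X -> set X :=
  (sval (cid (cover_meet_refines U V))).2.

Lemma meet1_refines U V : refines (cover_meet U V) U (meet1 U V).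
Proof. by rewrite /meet1; case: cid => ? []. Qed.

Lemma meet2_refines U V : refines (cover_meet U V) V (meet2 U V).
Proof. by rewrite /meet2; case: cid => ? []. Qed.

Lemma cech_rel_refl : reflexive cech_rel.
Proof.
move=> x; apply/asboolP; exists (cc_cover x), id, id.
by split; [exact: cc_open_cover|exact: refines_id|exact: refines_id|exact: cohomologous_refl].
Qed.

Lemma cech_rel_sym : symmetric cech_rel.
Proof.
by move=> x y; apply/asboolP/asboolP => -[W [p [q [oW hp hq h]]]];
  exists W, q, p; split=> //; exact: cohomologous_sym.
Qed.

Lemma cech_rel_trans : transitive cech_rel.
Proof.
move=> y x z /asboolP[W [p [q [oW hp hq h]]]].
move=> /asboolP[W' [q' [r [oW' hq' hr h']]]]; apply/asboolP.
have m1 := @meet1_refines W W'; have m2 := @meet2_refines W W'.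
exists (cover_meet W W'), (p \o meet1 W W'), (r \o meet2 W W').
split; [exact: cover_meet_open|exact: refines_comp hp|exact: refines_comp hr|].
apply: cohomologous_trans (cohomologous_pullback m1 h) _.
apply: cohomologous_trans (cohomologous_pullback m2 h').
exact: pullback_indep (refines_comp m1 hq) (refines_comp m2 hq') (@cc_cocycle y).
Qed.

Definition cech_equiv : equiv_rel cech_cocycle :=
  EquivRel cech_rel cech_rel_refl cech_rel_sym cech_rel_trans.

Definition cech_H1 : Type := {eq_quot cech_equiv}.

HB.instance Definition _ := Choice.on cech_H1.
HB.instance Definition _ := EqQuotient.on cech_H1.

Lemma cocycleD U c d : cocycle U c -> cocycle U d ->
  cocycle U (fun A B => c A B + d A B).
Proof.
move=> hc hd A B C UA UB UC ABC.
have := hc _ _ _ UA UB UC ABC; have := hd _ _ _ UA UB UC ABC.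
by move=> e1 e2; rewrite -[RHS]addr0 -{1}e1 -[in RHS]e2; ring.
Qed.

Lemma cocycleN U c : cocycle U c -> cocycle U (fun A B => - c A B).
Proof. by move=> hc A B C UA UB UC ABC; rewrite -!opprD hc // oppr0. Qed.

Lemma open_coverT : open_cover [set setT].
Proof. by split; [move=> _ ->; exact: openT|rewrite bigcup_set1]. Qed.

Lemma cocycle0 U : cocycle U (fun _ _ => 0).
Proof. by []. Qed.

Definition cech_zero : cech_cocycle :=
  CechCocycle open_coverT (@cocycle0 [set setT]).

Definition cech_opp (x : cech_cocycle) : cech_cocycle :=
  CechCocycle (cc_open_cover x) (cocycleN (@cc_cocycle x)).

Definition cech_add (x y : cech_cocycle) : cech_cocycle :=
  CechCocycle (cover_meet_open (cc_open_cover x) (cc_open_cover y))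
    (cocycleD
      (cocycle_pullback (@meet1_refines (cc_cover x) (cc_cover y))
         (@cc_cocycle x))
      (cocycle_pullback (@meet2_refines (cc_cover x) (cc_cover y))
         (@cc_cocycle y))).

Lemma cech_relI x y V : open_cover V ->
  (forall W r p q, refines W V r ->
    refines W (cc_cover x) p -> refines W (cc_cover y) q ->
    cohomologous W (pullback p (cc_cochain x)) (pullback q (cc_cochain y))) ->
  cech_rel x y.
Proof.
move=> oV h; apply/asboolP; set M := cover_meet (cc_cover x) (cc_cover y).
have oM : open_cover M by apply: cover_meet_open; exact: cc_open_cover.
have rM := @meet2_refines V M; have rx := @meet1_refines (cc_cover x) (cc_cover y).
have ry := @meet2_refines (cc_cover x) (cc_cover y).
exists (cover_meet V M), (meet1 (cc_cover x) (cc_cover y) \o meet2 V M).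
exists (meet2 (cc_cover x) (cc_cover y) \o meet2 V M); split.
- exact: cover_meet_open.
- exact: refines_comp rM rx.
- exact: refines_comp rM ry.
- apply: h (@meet1_refines V M) _ _; first exact: refines_comp rM rx.
  exact: refines_comp rM ry.
Qed.

Lemma cech_addP x y W p q s :
  refines W (cc_cover x) p -> refines W (cc_cover y) q ->
  refines W (cc_cover (cech_add x y)) s ->
  cohomologous W (pullback s (cc_cochain (cech_add x y)))
    (fun A B => pullback p (cc_cochain x) A B + pullback q (cc_cochain y) A B).
Proof.
move=> hp hq hs; apply: cohomologousD.
- exact: pullback_indep (refines_comp hs (@meet1_refines _ _)) hp
    (@cc_cocycle x).
- exact: pullback_indep (refines_comp hs (@meet2_refines _ _)) hq
    (@cc_cocycle y).
Qed.

Lemma cech_add_rel x x' y y' : cech_rel x x' -> cech_rel y y' ->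
  cech_rel (cech_add x y) (cech_add x' y').
Proof.
move=> /asboolP[W [p [p' [oW hp hp' h]]]].
move=> /asboolP[V [q [q' [oV hq hq' k]]]].
have m1 := @meet1_refines W V; have m2 := @meet2_refines W V.
apply: (cech_relI (cover_meet_open oW oV)) => N r s s' hr hs hs'.
have n1 := refines_comp hr m1; have n2 := refines_comp hr m2.
apply: cohomologous_trans
  (cech_addP (refines_comp n1 hp) (refines_comp n2 hq) hs) _.
apply: cohomologous_trans (cohomologous_sym
  (cech_addP (refines_comp n1 hp') (refines_comp n2 hq') hs')).
apply: cohomologousD; first exact: (cohomologous_pullback n1 h).
exact: (cohomologous_pullback n2 k).
Qed.

Lemma cech_opp_rel x x' : cech_rel x x' -> cech_rel (cech_opp x) (cech_opp x').
Proof.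
move=> /asboolP[W [p [p' [oW hp hp' h]]]]; apply/asboolP.
by exists W, p, p'; split=> //; exact: cohomologousN h.
Qed.

Lemma cech_addC_rel x y : cech_rel (cech_add x y) (cech_add y x).
Proof.
apply: (cech_relI (cc_open_cover (cech_add x y))) => W r p q hr hp hq.
have hx := refines_comp hr (@meet1_refines _ _).
have hy := refines_comp hr (@meet2_refines _ _).
apply: cohomologous_trans (cech_addP hx hy hp) _.
apply: cohomologous_trans (cohomologous_sym (cech_addP hy hx hq)).
exists (fun=> 0) => A B _ _ _.
by rewrite subrr addrC addrC [X in X - _]addrC subrr.
Qed.

Lemma cech_addA_rel x y z :
  cech_rel (cech_add x (cech_add y z)) (cech_add (cech_add x y) z).
Proof.
apply: (cech_relI (cc_open_cover (cech_add x (cech_add y z)))).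
move=> W r p q hr hp hq.
have hx := refines_comp hr (@meet1_refines _ _).
have hyz := refines_comp hr (@meet2_refines _ _).
have hy := refines_comp hyz (@meet1_refines _ _).
have hz := refines_comp hyz (@meet2_refines _ _).
have hxy := refines_comp hq (@meet1_refines _ _).
apply: cohomologous_trans (cech_addP hx hyz hp) _.
apply: cohomologous_trans (cohomologous_sym (cech_addP hxy hz hq)).
apply: cohomologous_trans
  (cohomologousD (cohomologous_refl _ _) (cech_addP hy hz hyz)) _.
apply: cohomologous_trans (cohomologous_sym
  (cohomologousD (cech_addP hx hy hxy) (cohomologous_refl _ _))).
by exists (fun=> 0) => A B _ _ _; rewrite addrA !subrr.
Qed.

Lemma cech_add0_rel x : cech_rel (cech_add cech_zero x) x.
Proof.
apply: (cech_relI (cc_open_cover (cech_add cech_zero x))).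
move=> W r p q hr hp hq.
have h0 := refines_comp hr (@meet1_refines _ _).
apply: cohomologous_trans (cech_addP h0 hq hp) _.
by exists (fun=> 0) => A B _ _ _; rewrite /pullback /= add0r !subrr.
Qed.

Lemma cech_addN_rel x : cech_rel (cech_add (cech_opp x) x) cech_zero.
Proof.
apply: (cech_relI (cc_open_cover (cech_add (cech_opp x) x))).
move=> W r p q hr hp hq.
have hx := refines_comp hr (@meet2_refines _ _).
apply: cohomologous_trans (cech_addP (x := cech_opp x) hx hx hp) _.
by exists (fun=> 0) => A B _ _ _; rewrite /pullback /= addNr !subrr.
Qed.

Local Open Scope quotient_scope.

Definition cech_H1_zero : cech_H1 := \pi_cech_H1 cech_zero.
Definition cech_H1_opp (a : cech_H1) : cech_H1 :=
  \pi_cech_H1 (cech_opp (repr a)).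
Definition cech_H1_add (a b : cech_H1) : cech_H1 :=
  \pi_cech_H1 (cech_add (repr a) (repr b)).

Lemma cech_H1_eqP (x y : cech_cocycle) :
  reflect (\pi_cech_H1 x = \pi_cech_H1 y) (cech_rel x y).
Proof. exact: (eqquotP (e := cech_equiv)). Qed.

Lemma cech_repr (x : cech_cocycle) : cech_rel (repr (\pi_cech_H1 x)) x.
Proof. by apply/cech_H1_eqP; rewrite reprK. Qed.

Lemma cech_H1_addE (x y : cech_cocycle) :
  cech_H1_add (\pi_cech_H1 x) (\pi_cech_H1 y) = \pi_cech_H1 (cech_add x y).
Proof. by apply/cech_H1_eqP/cech_add_rel; exact: cech_repr. Qed.

Lemma cech_H1_oppE (x : cech_cocycle) :
  cech_H1_opp (\pi_cech_H1 x) = \pi_cech_H1 (cech_opp x).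
Proof. by apply/cech_H1_eqP/cech_opp_rel; exact: cech_repr. Qed.

Lemma cech_H1_addA : associative cech_H1_add.
Proof.
elim/quotW=> x; elim/quotW=> y; elim/quotW=> z.
by rewrite (cech_H1_addE y z) (cech_H1_addE x y) !cech_H1_addE; apply/cech_H1_eqP; exact: cech_addA_rel.
Qed.

Lemma cech_H1_addC : commutative cech_H1_add.
Proof.
elim/quotW=> x; elim/quotW=> y.
by rewrite !cech_H1_addE; apply/cech_H1_eqP; exact: cech_addC_rel.
Qed.

Lemma cech_H1_add0 : left_id cech_H1_zero cech_H1_add.
Proof.
elim/quotW=> x.
by rewrite cech_H1_addE; apply/cech_H1_eqP; exact: cech_add0_rel.
Qed.

Lemma cech_H1_addN : left_inverse cech_H1_zero cech_H1_opp cech_H1_add.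
Proof.
elim/quotW=> x; rewrite cech_H1_oppE cech_H1_addE.
by apply/cech_H1_eqP; exact: cech_addN_rel.
Qed.

HB.instance Definition _ := GRing.isZmodule.Build cech_H1
  cech_H1_addA cech_H1_addC cech_H1_add0 cech_H1_addN.

End cech.

Definition isomorphic (G H : zmodType) : Prop :=
  exists f : {additive G -> H}, bijective f.

Definition finitely_generated (G : zmodType) : Prop :=
  exists (m : nat) (g : 'I_m -> G), forall x : G, exists c : 'I_m -> int,
    x = \sum_(i < m) g i *~ c i.

(** [zinv n] is [Z[1/n]] for [n > 0]; [zinv 0] is [Z]. *)
Section zinv.
Variable n : nat.

Definition in_zinv : {pred rat} :=
  fun q => `[< exists (m : int) (e : nat), q = m%:~R / n%:R ^+ e >].

Fact in_zinv_closed : zmod_closed in_zinv.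
Proof.
split=> [|x y]; first by apply/asboolP; exists 0, 0%N; rewrite mul0r.
move=> /asboolP[m [e ->]] /asboolP[m' [e' ->]]; apply/asboolP.
have [->|n0] := eqVneq n 0%N; last first.
  exists (m * (n ^ e')%N%:Z - m' * (n ^ e)%N%:Z), (e + e')%N.
  have nn (k : nat) : (n%:R ^+ k : rat) != 0 by rewrite expf_neq0 ?pnatr_eq0.
  rewrite rmorphB !rmorphM /= -!pmulrn !natrX exprD mulrBl invfM.
  rewrite mulrACA divff // mulr1; congr (_ - _).
  by rewrite [_^-1 * _]mulrC mulrACA divff // mulr1.
have h (k : int) (j : nat) : exists k' : int, k%:~R / 0%:R ^+ j = k'%:~R :> rat.
  case: j => [|j]; first by exists k; rewrite expr0 divr1.
  by exists 0; rewrite exprS mul0r invr0 mulr0.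
have [k ->] := h m e; have [k' ->] := h m' e'.
by exists (k - k'), 0%N; rewrite expr0 divr1 rmorphB.
Qed.

HB.instance Definition _ := GRing.isZmodClosed.Build rat in_zinv in_zinv_closed.

Record zinv := Zinv { zinv_val :> rat ; _ : zinv_val \in in_zinv }.

HB.instance Definition _ := [isSub for zinv_val].
HB.instance Definition _ := [Choice of zinv by <:].
HB.instance Definition _ := [SubChoice_isSubZmodule of zinv by <:].

End zinv.

Section direct_sum.
Variables (I : finType) (G : I -> zmodType).

Definition direct_sum : Type := forall i, G i.

HB.instance Definition _ := Choice.on direct_sum.

Definition dsum_zero : direct_sum := fun i => 0.
Definition dsum_opp (f : direct_sum) : direct_sum := fun i => - f i.
Definition dsum_add (f g : direct_sum) : direct_sum := fun i => f i + g i.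

Lemma dsum_addA : associative dsum_add.
Proof. by move=> f g h; apply: functional_extensionality_dep => i; exact: addrA. Qed.
Lemma dsum_addC : commutative dsum_add.
Proof. by move=> f g; apply: functional_extensionality_dep => i; exact: addrC. Qed.
Lemma dsum_add0 : left_id dsum_zero dsum_add.
Proof. by move=> f; apply: functional_extensionality_dep => i; exact: add0r. Qed.
Lemma dsum_addN : left_inverse dsum_zero dsum_opp dsum_add.
Proof. by move=> f; apply: functional_extensionality_dep => i; exact: addNr. Qed.

HB.instance Definition _ := GRing.isZmodule.Build direct_sum
  dsum_addA dsum_addC dsum_add0 dsum_addN.

End direct_sum.

(* Main.v *)
(** The group [G + Z[1/n_1] + ... + Z[1/n_k]] has finite rank, so it suffices
    to find a system whose tiling space has [H^1] of infinite rank.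

    The substitutions [l |-> l b] ([b = 0, 1]), fixing the letters [0] and
    [1], satisfy [phi_{a_0} \o ... \o phi_{a_n} (l) = l a_0 ... a_n].  If every
    binary word occurs in [a_0 a_1 a_2 ...], every sequence over [{0, 1}] is
    admitted.  A locally constant [f] on the hull defines a class in [H^1] of
    the suspension, and this class can only vanish when [f = e \o sigma - e]
    for some [e], so that the sums of [f] along periodic orbits vanish.  For
    the indicators [f_i] of the words [1 0^i 1], the sum of [f_i] along the
    orbit of the periodic sequence of period word [1 0^j] is [delta_ij], so
    their classes are independent. *)

Require Import Defs.
From HB Require Import structures.
From mathcomp Require Import all_boot all_order all_algebra generic_quotient.
From mathcomp Require Import all_classical all_reals topology normedtype.
From mathcomp Require Import ring lra zify.

Set Implicit Arguments.
Unset Strict Implicit.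
Unset Printing Implicit Defensive.

Import Order.TTheory GRing.Theory Num.Theory.
Import numFieldNormedType.Exports.
Local Open Scope classical_set_scope.
Local Open Scope ring_scope.
Local Open Scope quotient_scope.

(** * First Cech cohomology of the suspension and functions on the hull *)

Section suspension_cohomology.
Variables (R : realType) (A : finType) (S : mixed_system A).
Local Notation cyl := (cylinder R S).
Local Notation X := (tiling_space R S).
Local Notation I := (set_type (@unit_interval R)).
Local Notation H := (set_type (hull S)).

Definition suspension_pi : cyl -> X := \pi_{eq_quot (suspension_equiv R S)}.
Local Notation pi := suspension_pi.

Lemma suspension_pi_glued (y y' : cyl) : glued y y' -> pi y = pi y'.
Proof. by move=> g; apply/eqquotP/asboolP; constructor 2. Qed.

Lemma suspension_pi_eq (y y' : cyl) :
  pi y = pi y' -> [\/ y = y', glued y y' | glued y' y].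
Proof. by move/eqquotP/asboolP. Qed.

Lemma suspension_pi_repr (q : X) : pi (repr q) = q.
Proof. exact: reprK. Qed.

Lemma fiber_continuous (x : H) : continuous (fun t : I => pi (x, t)).
Proof.
move=> t U; rewrite nbhsE => -[V [oV Vt] VU].
have oV' : open (pi @^-1` V) by exact: oV.
have /= [[B C] [/= nB nC] BC] : nbhs (x, t) (pi @^-1` V) by exact: open_nbhs_nbhs.
apply: filterS nC => s Cs; apply/VU/(BC (x, s)); split=> //.
exact: nbhs_singleton.
Qed.

Fact clamp_subproof (r : R) : @unit_interval R (Num.max 0 (Num.min r 1)).
Proof. by rewrite /unit_interval /=; apply/andP; split; rewrite ?le_max ?ge_max ?ge_min ?lexx ?ler01 ?orbT. Qed.

Definition clamp (r : R) : I := SigSub (mem_set (clamp_subproof r)).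

Lemma clamp_continuous : continuous clamp.
Proof.
apply: continuous_comp_initial => r.
apply: (@continuous_max _ _ (fun=> 0) (fun r : R => Num.min r 1)).
  exact: cvg_cst.
apply: (@continuous_min _ _ id (fun=> 1)); first exact: cvg_id.
exact: cvg_cst.
Qed.

Lemma val_clamp (r : R) : 0 <= r <= 1 -> set_val (clamp r) = r.
Proof. by move=> /andP[r0 r1]; rewrite set_valE /= min_l // max_r. Qed.

Lemma clampK (t : I) : clamp (set_val t) = t.
Proof.
apply: val_inj; rewrite -!set_valE val_clamp //.
exact: (set_valP t).
Qed.

(** Pulled back along the retraction [clamp], a level set of [g] and its complement are both open in
    the line, which is connected. *)
Lemma locally_constant_unit_interval (T : Type) (g : I -> T) :
  (forall t, \forall s \near t, g s = g t) -> forall s t, g s = g t.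
Proof.
move=> gP s t; pose B := [set r | g (clamp r) = g t].
have o (Q : T -> Prop) : open [set r | Q (g (clamp r))].
  rewrite openE => r /= Qr.
  have n : \forall u \near r, g (clamp u) = g (clamp r).
    exact: (@clamp_continuous r _ (gP (clamp r))).
  rewrite /interior /=; near=> u => /=; suff -> : g (clamp u) = g (clamp r) by [].
  by near: u.
have c : connected [set: R] by apply/connected_intervalP.
have -> : s = clamp (set_val s) by rewrite clampK.
suff: B = setT by move/seteqP => -[_ /(_ (set_val s) Logic.I)].
apply: c.
- by exists (set_val t); rewrite /B /= clampK.
- by exists B; [exact: (o (fun z => z = g t))|rewrite setTI].
- exists B; last by rewrite setTI.
  by rewrite -openC; exact: (o (fun z => z <> g t)).
Unshelve. all: by end_near. Qed.

(** The pullback of a cocycle to the cylinder is trivialised by the [theta U],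
    and [f] records the monodromy of this trivialisation around the
    suspension direction. *)
Definition represents (x : cech_cocycle X) (f : H -> int) : Prop :=
  exists theta : set X -> cyl -> int,
  [/\ forall U V, cc_cover x U -> cc_cover x V -> forall y,
        U (pi y) -> V (pi y) -> cc_cochain x U V = theta V y - theta U y,
      forall U, cc_cover x U -> forall a t, U (pi (a, t)) ->
        \forall s \near t, theta U (a, s) = theta U (a, t) &
      forall U, cc_cover x U -> forall y y' : cyl, glued y y' -> U (pi y) ->
        theta U y - theta U y' = f y.1].

Definition representsH (h : cech_H1 X) (f : H -> int) : Prop :=
  exists2 x, h = \pi_(cech_H1 X) x & represents x f.

Lemma representsH0 : representsH 0 (fun=> 0).
Proof.
exists (cech_zero X); first by [].
exists (fun _ _ => 0); split.
- by move=> *; rewrite subrr.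
- by move=> U _ a t _; near=> s.
- by move=> *; rewrite subrr.
Unshelve. all: by end_near. Qed.

Lemma representsHN h f : representsH h f -> representsH (- h) (fun a => - f a).
Proof.
case=> x -> [theta [h1 h2 h3]]; exists (cech_opp x); first exact: cech_H1_oppE.
exists (fun U y => - theta U y); split => /=.
- by move=> U V UU VV y Uy Vy; rewrite (h1 U V UU VV y) //; ring.
- move=> U UU a t Ut; have := h2 U UU a t Ut.
  by apply: filterS => s ->.
- by move=> U UU y y' g Uy; rewrite -(h3 U UU y y') //; ring.
Qed.

Lemma representsHD h f h' f' : representsH h f -> representsH h' f' ->
  representsH (h + h') (fun a => f a + f' a).
Proof.
case=> x -> [theta [h1 h2 h3]]; case=> x' -> [theta' [h1' h2' h3']].
exists (cech_add x x'); first exact: cech_H1_addE.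
have r1 := @meet1_refines _ (cc_cover x) (cc_cover x').
have r2 := @meet2_refines _ (cc_cover x) (cc_cover x').
exists (fun U y => theta (meet1 (cc_cover x) (cc_cover x') U) y +
                   theta' (meet2 (cc_cover x) (cc_cover x') U) y); split.
- move=> U V UU VV y Uy Vy /=.
  have [U1 /(_ _ Uy) Uy1] := r1 U UU; have [V1 /(_ _ Vy) Vy1] := r1 V VV.
  have [U2 /(_ _ Uy) Uy2] := r2 U UU; have [V2 /(_ _ Vy) Vy2] := r2 V VV.
  by rewrite /pullback (h1 _ _ U1 V1 y) // (h1' _ _ U2 V2 y) //; ring.
- move=> U UU a t Ut.
  have [U1 /(_ _ Ut) Ut1] := r1 U UU; have [U2 /(_ _ Ut) Ut2] := r2 U UU.
  have n1 := h2 _ U1 a t Ut1; have n2 := h2' _ U2 a t Ut2.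
  by apply: filterS2 n1 n2 => s -> ->.
- move=> U UU y y' g Uy.
  have [U1 /(_ _ Uy) Uy1] := r1 U UU; have [U2 /(_ _ Uy) Uy2] := r2 U UU.
  by rewrite -(h3 _ U1 y y') // -(h3' _ U2 y y') //; ring.
Qed.

Lemma representsHMz h f (n : int) :
  representsH h f -> representsH (h *~ n) (fun a => f a * n).
Proof.
move=> hf; have nat_case (k : nat) : representsH (h *~ k) (fun a => f a * k%:Z).
  elim: k => [|k IH].
    by rewrite (_ : (fun _ => _) = fun=> 0);
      [exact: representsH0|apply/funext => a; rewrite mulr0].
  rewrite intS mulrzDr mulr1z.
  rewrite (_ : (fun _ => _) = fun a => f a + f a * k%:Z); first exact: representsHD.
  by apply/funext => a; rewrite mulrDr mulr1.
case: n => k; first exact: nat_case.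
rewrite NegzE mulrNz.
rewrite (_ : (fun _ => _) = fun a => - (f a * k.+1%:Z)); first exact/representsHN.
by apply/funext => a; rewrite mulrN.
Qed.

Lemma representsH_sum (J : Type) (r : seq J) (h : J -> cech_H1 X) (f : J -> H -> int)
    (n : J -> int) : (forall i, representsH (h i) (f i)) ->
  representsH (\sum_(i <- r) h i *~ n i) (fun a => \sum_(i <- r) f i a * n i).
Proof.
move=> hf; elim: r => [|i r IH].
  rewrite big_nil (_ : (fun _ => _) = fun=> 0); first exact: representsH0.
  by apply/funext => a; rewrite big_nil.
rewrite big_cons (_ : (fun _ => _) =
  fun a => f i a * n i + \sum_(i <- r) f i a * n i).
  by apply: representsHD => //; exact: representsHMz.
by apply/funext => a; rewrite big_cons.
Qed.

(** On a cover [W] where [b] trivialises the class, the sums [b U + theta (q U)] agree on overlaps.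
    They glue to a function [D] on the cylinder that is constant on each fibre and whose jump across
    the gluing is [f]. *)
Lemma representsH0_coboundary f : representsH 0 f ->
  exists e : H -> int, forall a a' : H,
    set_val a' = Defs.shift (set_val a) :> (int -> A) -> f a = e a' - e a.
Proof.
case=> x x0 [theta [h1 h2 h3]].
have /asboolP[W [p [q [oW hp hq [b hb]]]]] : cech_rel (cech_zero X) x.
  by apply/cech_H1_eqP; rewrite -x0.
have /choice[N hN] (y : cyl) : exists U, W U /\ U (pi y).
  have : (\bigcup_(U in W) U) (pi y) by rewrite oW.2.
  by case=> U WU Uy; exists U.
pose D (y : cyl) := b (N y) + theta (q (N y)) y.
have DE y U : W U -> U (pi y) -> D y = b U + theta (q U) y.
  move=> WU Uy; have [WN Ny] := hN y.
  have [xU /(_ _ Uy) qU] := hq _ WU; have [xN /(_ _ Ny) qN] := hq _ WN.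
  have := hb (N y) U WN WU (ex_intro _ (pi y) (conj Ny Uy)).
  rewrite /pullback /= sub0r (h1 _ _ xN xU y) // => e.
  apply/eqP; rewrite -subr_eq0 /D; apply/eqP.
  have -> : b (N y) + theta (q (N y)) y - (b U + theta (q U) y) =
    - (theta (q U) y - theta (q (N y)) y) - (b U - b (N y)) by ring.
  by rewrite e subrr.
have Dconst (a : H) (s t : I) : D (a, s) = D (a, t).
  apply: (@locally_constant_unit_interval _ (fun t => D (a, t))) => {}t.
  set U := N (a, t); have [WU Ut] := hN (a, t).
  have [xU /(_ _ Ut) qU] := hq _ WU.
  have n1 := h2 _ xU a t qU.
  have n2 : \forall s \near t, U (pi (a, s)).
    apply: (@fiber_continuous a t U); apply: open_nbhs_nbhs; split=> //.
    exact: oW.1.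
  near=> s'; rewrite (DE (a, s') U) //; last by near: s'.
  rewrite (DE (a, t) U) //; congr (_ + _); by near: s'.
(* [D] drops by [f a] from the top of the fibre of [a] to the bottom of the next one; the minus sign
   turns this drop into [e a' - e a]. *)
exists (fun a => - D (a, clamp 0)) => a a' aa'.
have g : glued (a, clamp 1) (a', clamp 0) :> Prop.
  by split=> //=; rewrite val_clamp ?lexx ?ler01.
have [WU Ut] := hN (a, clamp 1); set U := N _ in WU Ut.
have [xU /(_ _ Ut) qU] := hq _ WU.
rewrite (Dconst a (clamp 0) (clamp 1)) (DE (a, clamp 1) U) // (DE (a', clamp 0) U) //.
  by rewrite -(h3 _ xU _ _ g qU) /=; ring.
by rewrite -(suspension_pi_glued g).
Unshelve. all: by end_near. Qed.

(** A cochain gives one integer per pair of sets, so the differences of [theta] have to be constant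
    on each whole intersection. Being differences, they satisfy the cocycle identity at any common
    point. *)
Lemma represents_exists (U : set (set X)) (theta : set X -> cyl -> int) (f : H -> int) :
  open_cover U ->
  (forall V W, U V -> U W -> exists k, forall y,
     V (pi y) -> W (pi y) -> theta W y - theta V y = k) ->
  (forall V, U V -> forall a t, V (pi (a, t)) ->
     \forall s \near t, theta V (a, s) = theta V (a, t)) ->
  (forall V, U V -> forall y y' : cyl, glued y y' -> V (pi y) ->
     theta V y - theta V y' = f y.1) ->
  exists h, representsH h f.
Proof.
move=> oU hk h2 h3.
have /choice[c hc] (VW : set X * set X) : exists k, U VW.1 -> U VW.2 ->
    forall y, VW.1 (pi y) -> VW.2 (pi y) -> theta VW.2 y - theta VW.1 y = k.
  case: VW => V W /=; have [[UV UW]|n] := pselect (U V /\ U W).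
    by have [k e] := hk _ _ UV UW; exists k.
  by exists 0 => UV UW; case: n.
have coc : cocycle U (fun V W => c (V, W)).
  move=> V1 V2 V3 U1 U2 U3 [z [[z1 z2] z3]].
  rewrite -(suspension_pi_repr z) in z1 z2 z3.
  by rewrite -(hc (V1, V2) U1 U2 _ z1 z2) -(hc (V2, V3) U2 U3 _ z2 z3)
    -(hc (V1, V3) U1 U3 _ z1 z3) /=; ring.
exists (\pi_(cech_H1 X) (CechCocycle oU coc)), (CechCocycle oU coc) => //.
exists theta; split=> //= V W UV UW y Vy Wy.
by rewrite -(hc (V, W) UV UW y).
Qed.

(** * Charts on the suspension, and classes of locally constant functions *)

Definition saturated (P : set cyl) : Prop :=
  forall y y', glued y y' -> P y <-> P y'.

(** Testing the chosen representative gives the image of [P] when [P] is saturated. *)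
Definition descend (P : set cyl) : set X := [set q | P (repr q)].

Lemma descend_pi P y : saturated P -> descend P (pi y) <-> P y.
Proof.
move=> sP; rewrite /descend /=.
have [->|/sP//|/sP h] := @suspension_pi_eq (repr (pi y)) y (suspension_pi_repr _).
- by [].
- by split=> /h.
Qed.

Lemma descend_open P : saturated P -> open P -> open (descend P).
Proof.
move=> sP oP; rewrite (_ : open _ = open (pi @^-1` (descend P))) //.
rewrite (_ : _ @^-1` _ = P) //.
by apply/seteqP; split=> y /=; rewrite descend_pi.
Qed.

Lemma open_height (P : set R) : open P -> open [set y : cyl | P (set_val y.2)].
Proof.
move=> oP.
have c : continuous (fun y : cyl => set_val y.2 : R).
  move=> y; apply: (@continuous_comp _ _ _ snd (set_val : I -> R)).
    exact: cvg_snd.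
  exact: initial_continuous.
by apply: open_comp oP => y _; exact: c.
Qed.

Lemma open_base (P : set H) : open P -> open [set y : cyl | P y.1].
Proof. by move=> oP; apply: open_comp oP => y _; exact: cvg_fst. Qed.

(** The circle direction is covered by three arcs; the arc [Some (Some v)] is
    moreover cut along the level sets of [f], so that the values of
    [chart_value] on two charts differ by a constant on their intersection. *)
Definition chart (f : H -> int) (k : option (option int)) : set cyl :=
  match k with
  | None => [set y | set_val y.2 < 3^-1 \/ 2 / 3 < set_val y.2]
  | Some None => [set y | 0 < set_val y.2 < 2 / 3]
  | Some (Some v) => [set y | 3^-1 < set_val y.2 < 1 /\ f y.1 = v]
  end.

(** The jump is placed on the chart through the seam. The threshold [2^-1] lies in the gap between
    1/3 and 2/3 that this chart leaves out, so the value is locally constant along each fibre. *)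
Definition chart_value (f : H -> int) (k : option (option int)) (y : cyl) : int :=
  match k with
  | None => if set_val y.2 < 2^-1 then 0 else f y.1
  | Some None => 0
  | Some (Some v) => v
  end.

Lemma chart_saturated f k : saturated (chart f k).
Proof.
move=> y y' [e1 e0 _]; case: k => [[v|]|] /=; rewrite e1 e0.
- by split=> -[/andP[? ?] _]; exfalso; lra.
- by split=> ?; lra.
- by split=> _; [left|right]; lra.
Qed.

Lemma chart_open f k : (forall v, open [set a | f a = v]) -> open (chart f k).
Proof.
move=> of_; case: k => [[v|]|] /=.
- have -> : [set y : cyl | 3^-1 < set_val y.2 < 1 /\ f y.1 = v] =
      [set y : cyl | `]3^-1, 1[%classic (set_val y.2)] `&` [set y : cyl | f y.1 = v].
    by apply/seteqP; split=> y /=; rewrite in_itv.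
  apply: openI; last exact: (open_base (of_ v)).
  by apply: open_height; exact: interval_open.
- have -> : [set y : cyl | 0 < set_val y.2 < 2 / 3] =
      [set y : cyl | `]0, 2 / 3[%classic (set_val y.2)].
    by apply/seteqP; split=> y /=; rewrite in_itv.
  by apply: open_height; exact: interval_open.
- apply: (@open_height [set r | r < 3^-1 \/ 2 / 3 < r]).
  by apply: openU; [exact: open_lt|exact: open_gt].
Qed.

Lemma chart_cover f y : exists k, chart f k y.
Proof.
have /= /andP[t0 t1] := set_valP y.2; rewrite -set_valE in t0 t1.
have [?|?] := ltP (set_val y.2) 3^-1; first by exists None; left.
have [?|?] := ltP (set_val y.2) (2 / 3); first by exists (Some None) => /=; lra.
have [?|?] := ltP (set_val y.2) 1; last by exists None; right; lra.
by exists (Some (Some (f y.1))); split=> //; lra.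
Qed.

(** The chart [None] meets [Some None] only below 1/3, where its value is 0, and meets
    [Some (Some v)] only above 2/3, where its value is [f y.1 = v]. *)
Lemma chart_value_diff f k l : exists d, forall y, chart f k y -> chart f l y ->
  chart_value f l y - chart_value f k y = d.
Proof.
move: k l => [[v|]|] [[w|]|].
- by exists (w - v).
- by exists (0 - v).
- by exists 0 => y /= [? <-] ?; rewrite ifN ?subrr //; lra.
- by exists (w - 0).
- by exists (0 - 0).
- by exists 0 => y /= ? ?; rewrite ifT ?subrr //; lra.
- by exists 0 => y /= ? [? <-]; rewrite ifN ?subrr //; lra.
- by exists 0 => y /= ? ?; rewrite ifT ?subrr //; lra.
- by exists 0 => y _ _; rewrite subrr.
Qed.

Lemma chart_value_near f k a t : chart f k (a, t) ->
  \forall s \near t, chart_value f k (a, s) = chart_value f k (a, t).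
Proof.
have near_open (P : set R) : open P -> P (set_val t) -> \forall s \near t, P (set_val s).
  move=> oP Pt; apply: (@initial_continuous _ _ (set_val : I -> R) t).
  exact: open_nbhs_nbhs.
case: k => [[v|]|] /=; [by move=> _; near=> s|by move=> _; near=> s|case=> ht].
- have n := near_open _ (@open_lt _ 3^-1) ht.
  near=> s; have /= hs : [set r | r < 3^-1] (set_val s) by near: s.
  by rewrite !ifT //; lra.
- have n := near_open _ (@open_gt _ (2 / 3)) ht.
  near=> s; have /= hs : [set r | 2 / 3 < r] (set_val s) by near: s.
  by rewrite !ifN //; lra.
Unshelve. all: by end_near. Qed.

Lemma locally_constant_represented (f : H -> int) :
  (forall v, open [set a | f a = v]) -> exists h, representsH h f.
Proof.
move=> of_; pose U := range (fun k => descend (chart f k)).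
(* Different indices can give the same set, so an index is chosen for each member of the cover. *)
have /choice[kind hkind] (V : set X) : exists k, U V -> V = descend (chart f k).
  have [[k _ <-]|n] := pselect (U V); first by exists k.
  by exists None.
have V_chart V y : U V -> V (pi y) -> chart f (kind V) y.
  by move=> /hkind{1}->; rewrite descend_pi //; exact: chart_saturated.
apply: (@represents_exists U (fun V => chart_value f (kind V))).
- split=> [_ [k _ <-]|]; first exact/(descend_open (@chart_saturated f k))/chart_open.
  rewrite -subTset => q _; have [k hk] := chart_cover f (repr q).
  by exists (descend (chart f k)) => //; exists k.
- move=> V W UV UW; have [d hd] := chart_value_diff f (kind V) (kind W).
  by exists d => y Vy Wy; apply: hd; exact: V_chart.
- by move=> V UV a t Vt; apply/chart_value_near/V_chart.
- move=> V UV y y' g /(V_chart _ _ UV).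
  have [e1 e0 _] := g; case: (kind V) => [[v|]|] /=; rewrite e1 ?e0.
  + by move=> [? _]; exfalso; lra.
  + by move=> ?; exfalso; lra.
  + by move=> _; rewrite ifN ?ifT ?subr0 //; lra.
Qed.

(** If a combination of the classes vanishes, the same combination of the [f i] is a coboundary and
    telescopes to 0 around a closed orbit; around orbit [j] it sums to [n j]. *)
Lemma orbit_sum_independent (N : nat) (f : 'I_N -> H -> int) (orb : 'I_N -> nat -> H)
    (p : 'I_N -> nat) :
  (forall i v, open [set a | f i a = v]) ->
  (forall j t, set_val (orb j t.+1) = Defs.shift (set_val (orb j t)) :> (int -> A)) ->
  (forall j, orb j (p j) = orb j 0%N) ->
  (forall i j, \sum_(0 <= t < p j) f i (orb j t) = (i == j)%:Z) ->
  exists h : 'I_N -> cech_H1 X, forall n : 'I_N -> int,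
    \sum_i h i *~ n i = 0 -> forall j, n j = 0.
Proof.
move=> of_ orbS orbp sum_f.
have /choice[h hf] i := locally_constant_represented (of_ i).
exists h => n hn j.
have := @representsH_sum _ (index_enum 'I_N) h f n hf.
rewrite hn => /representsH0_coboundary[e he].
have : \sum_(0 <= t < p j) \sum_i f i (orb j t) * n i = 0.
  under eq_bigr => t _ do rewrite (he _ _ (orbS j t)).
  by rewrite telescope_sumr // orbp subrr.
rewrite exchange_big /= (bigD1 j) //= -mulr_suml sum_f eqxx mul1r big1 ?addr0 //.
by move=> i ij; rewrite -mulr_suml sum_f (negPf ij) mul0r.
Qed.

End suspension_cohomology.

(** * Integer relations in groups of finite rank *)

Section finite_rank.
Variables (G : zmodType) (k : nat) (n : 'I_k -> nat).
Local Notation H := (G * direct_sum (fun i => zinv (n i)))%type.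

Definition zinv_coord (l : 'I_k) (y : H) : rat := zinv_val (y.2 l).

Fact zinv_coord_is_additive l : zmod_morphism (zinv_coord l).
Proof. by []. Qed.

HB.instance Definition _ l :=
  GRing.isZmodMorphism.Build H rat (zinv_coord l) (zinv_coord_is_additive l).

(** The rank is at most [q < p], so a nonzero rational row vector kills [M]; clearing denominators
    makes it integral. *)
Lemma rat_kernel_int (p q : nat) (M : 'M[rat]_(p, q)) : (q < p)%N ->
  exists c : 'I_p -> int, (exists i, c i != 0) /\
    forall j, \sum_i (c i)%:~R * M i j = 0.
Proof.
move=> qp; have : kermx M != 0.
  rewrite kermx_eq0 /row_free; apply: contraTneq qp => <-.
  by rewrite -leqNgt rank_leq_col.
case/rowV0Pn => u /sub_kermxP uM u0.
pose d : int := \prod_i denq (u 0 i).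
have d0 : d != 0 by apply/prodf_neq0 => i _; exact: denq_neq0.
pose c i : int := numq (u 0 i) * \prod_(j | j != i) denq (u 0 j).
have cE i : (c i)%:~R = d%:~R * u 0 i :> rat.
  by rewrite /c /d [in RHS](bigD1 i) //= !intrM numqE; ring.
exists c; split.
  have [i ui] : exists i, u 0 i != 0.
    apply/existsP; apply: contraNT u0; rewrite negb_exists => /forallP h.
    by apply/eqP/rowP => i; rewrite mxE; apply/eqP; move: (h i); rewrite negbK.
  by exists i; rewrite -(intr_eq0 rat) cE mulf_neq0 // intr_eq0.
move=> j; have := congr1 (fun B : 'rV_q => B 0 j) uM; rewrite !mxE => e.
under eq_bigr => i _ do rewrite cE -mulrA.
by rewrite -mulr_sumr e mulr0.
Qed.

(** Each element is recorded by a row of [m] coefficients on the generators of [G] and [k] rational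
    coordinates. Among [m + k + 1] rows there is an integer relation, which passes from the
    coefficients to [G] even if the generators satisfy relations. *)
Lemma zinv_sum_dependent : finitely_generated G ->
  exists N, forall y : 'I_N -> H, exists c : 'I_N -> int,
    (exists i, c i != 0) /\ \sum_i y i *~ c i = 0.
Proof.
case=> m [g gen]; exists (m + k).+1 => y.
have /choice[b hb] i := gen (y i).1.
pose M : 'M[rat]_((m + k).+1, m + k) :=
  row_mx (\matrix_(i, j) (b i j)%:~R) (\matrix_(i, l) zinv_coord l (y i)).
have [c [c0 cM]] := rat_kernel_int M (ltnSn _).
exists c; split=> //; rewrite [LHS]surjective_pairing; congr pair.
- rewrite (raddf_sum fst) /=.
  under eq_bigr => i _ do rewrite (raddfMz fst) /= hb mulrz_suml.
  rewrite exchange_big /= big1 // => j _.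
  under eq_bigr => i _ do rewrite -mulrzA.
  rewrite -mulrz_sumr; have := cM (lshift k j).
  under eq_bigr => i _ do rewrite row_mxEl mxE -intrM mulrC.
  rewrite -(raddf_sum (intmul 1)) => /eqP; rewrite intr_eq0 => /eqP ->.
  by rewrite mulr0z.
- apply: functional_extensionality_dep => l; apply: val_inj.
  change (zinv_coord l (\sum_i y i *~ c i) = 0); rewrite raddf_sum.
  have := cM (rshift m l).
  under eq_bigr => i _ do rewrite row_mxEr mxE mulrzl.
  by under [in X in _ -> X]eq_bigr => i _ do rewrite raddfMz.
Qed.

End finite_rank.

(** * A substitution system admitting every binary sequence *)

Local Notation letter := (option bool).

(** [None] is the letter [l] of the header. *)
Definition append_letter (b : bool) (l : letter) : seq letter :=
  if l is None then [:: None; Some b] else [:: l].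

Fact append_letter_neq0 b l : append_letter b l != [::].
Proof. by case: l. Qed.

Definition append_subst b : substitution letter :=
  Substitution (append_letter_neq0 b).

Definition append_system (a : nat -> bool) : mixed_system letter :=
  MixedSystem (fun i : 'I_2 => append_subst (i == 1 :> nat))
              (fun n => inord (a n)).

(** The innermost substitution puts [a n] after [None]; the outer ones fix that letter and only
    expand [None]. The induction therefore peels the range from its end. *)
Lemma append_subst_range a n :
  subst_range (append_system a) 0 n [:: None] =
  None :: [seq Some (a i) | i <- iota 0 n.+1].
Proof.
pose f i := subst_word (ms_subst (ms_seq (append_system a) i)).
have fE i : f i = subst_word (append_subst (a i)).
  by rewrite /f /= inordK; case: (a i).
have f_fixed r w : foldr f [seq Some b | b <- w] r = [seq Some b | b <- w].
  elim: r => //= i r ->; rewrite fE /subst_word -map_comp.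
  by elim: w => //= b w ->.
have f_cat r u v : foldr f (u ++ v) r = foldr f u r ++ foldr f v r.
  by elim: r => //= i r ->; rewrite /f /subst_word map_cat flatten_cat.
rewrite /subst_range /index_iota subn0 -/f.
elim: {n}n.+1 => // n IH; rewrite -addn1 iotaD foldr_cat map_cat /= add0n.
have -> : f n [:: None] = [:: None] ++ [seq Some b | b <- [:: a n]] by rewrite fE.
by rewrite f_cat f_fixed IH.
Qed.

(** The leading [false] makes [all_words n] have length at least [n]. *)
Definition all_words (n : nat) : seq bool :=
  flatten [seq false :: odflt [::] (unpickle k) | k <- iota 0 n].

(** The limit of the prefixes [all_words n]. Since [all_words i.+1] has more than [i] letters, the
    default [false] is never returned. *)
Definition universal_sequence (i : nat) : bool := nth false (all_words i.+1) i.

Lemma all_words_prefix m n : (m <= n)%N -> exists w, all_words n = all_words m ++ w.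
Proof.
move=> mn; rewrite /all_words -(subnKC mn) iotaD map_cat flatten_cat.
by eexists.
Qed.

Lemma size_all_words n : (n <= size (all_words n))%N.
Proof.
elim: n => // n IH; rewrite /all_words -addn1 iotaD map_cat flatten_cat size_cat.
by rewrite leq_add.
Qed.

(** Of [all_words n] and [all_words i.+1] one is a prefix of the other, so they agree at [i]. *)
Lemma universal_sequence_prefix n :
  [seq universal_sequence i | i <- iota 0 (size (all_words n))] = all_words n.
Proof.
apply: (@eq_from_nth _ false) => [|i]; rewrite size_map size_iota // => ltin.
rewrite (nth_map 0%N) ?size_iota // nth_iota // add0n /universal_sequence.
have lti := size_all_words i.+1.
by have [/all_words_prefix[w ->]|/ltnW/all_words_prefix[w ->]] := leqP i.+1 n;
  rewrite nth_cat ?lti ?ltin.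
Qed.

Lemma infix_all_words (w : seq bool) : infix w (all_words (pickle w).+1).
Proof.
rewrite /all_words -addn1 iotaD map_cat flatten_cat add0n; rewrite [iota _ 1]/= map_cons pickleK /= cats0.
by apply/infixP; exists (all_words (pickle w) ++ [:: false]), [::]; rewrite cats0 -catA.
Qed.

Definition universal_system := append_system universal_sequence.

Lemma universal_admitted (x : int -> letter) :
  (forall z, x z != None) -> admitted universal_system x.
Proof.
move=> x0 t u; pose w := [seq odflt false (x (t + i%:Z)) | i <- iota 0 u.+1].
pose v := all_words (pickle w).+1.
have v0 : (0 < size v)%N by apply: leq_trans (size_all_words _).
(* Composing up to [n] yields [n.+1] binary letters after [None], hence the predecessor. *)
exists (size v).-1, None; rewrite append_subst_range prednK //.
rewrite (map_comp Some) universal_sequence_prefix.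
have -> : Defs.factor x t u = [seq Some b | b <- w].
  rewrite /Defs.factor /w -map_comp; apply: eq_map => i /=.
  by case: (x _) (x0 (t + i%:Z)).
have /infixP[s1 [s2 e]] := infix_all_words w; rewrite -/v in e *.
by apply/infixP; exists (None :: map Some s1), (map Some s2); rewrite e !map_cat.
Qed.

(** * Sequences of period word 1 0^j and indicators of the words 1 0^i 1 *)

Definition periodic_point (j t : nat) (z : int) : letter :=
  Some (j.+1 %| z + t%:Z)%Z.

Lemma periodic_point_hull j t : hull universal_system (periodic_point j t).
Proof. exact: universal_admitted. Qed.

Definition periodic_orbit (j t : nat) : set_type (hull universal_system) :=
  SigSub (mem_set (periodic_point_hull j t)).

Lemma periodic_orbit_shift j t : set_val (periodic_orbit j t.+1) =
  Defs.shift (set_val (periodic_orbit j t)) :> (int -> letter).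
Proof.
rewrite !set_valE /=; apply/funext => z; rewrite /Defs.shift /periodic_point.
by rewrite intS addrA.
Qed.

Lemma periodic_orbit_period j : periodic_orbit j j.+1 = periodic_orbit j 0.
Proof.
apply: val_inj; apply/funext => z /=; rewrite /periodic_point addr0.
by rewrite rpredDr ?dvdzz.
Qed.

Definition window (i : nat) (a : set_type (hull universal_system)) : seq letter :=
  [seq (set_val a : int -> letter) k%:Z | k <- iota 0 i.+2].

(** The indicator [f_i] of the word 1 0^i 1 at the origin: the sequence of period [i.+1] shows
    exactly this word at positions 0 to [i.+1]. *)
Definition window_count (i : nat) (a : set_type (hull universal_system)) : int :=
  (window i a == window i (periodic_orbit i 0))%:Z.

Lemma window_near i a : \forall b \near a, window i b = window i a.
Proof.
rewrite /window; elim: (iota 0 i.+2) => [|k r IH] /=; first by near=> b.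
have n : \forall b \near a, (set_val b : int -> letter) k%:Z = (set_val a : int -> letter) k%:Z.
  have c : continuous (proj k%:Z \o set_val :
      set_type (hull universal_system) -> discrete_topology letter).
    move=> b; apply: (@continuous_comp _ (full_shift letter)).
      exact: initial_continuous.
    exact: (@proj_continuous int (fun=> discrete_topology letter)).
  exact: (c a _ (discrete_set1 _)).
by near=> b; congr cons; near: b.
Unshelve. all: by end_near. Qed.

Lemma window_count_locally_constant i v : open [set a | window_count i a = v].
Proof.
rewrite openE => a /= <-; rewrite /interior /=; near=> b => /=.
by rewrite /window_count; congr ((_ == _) : nat)%:Z; near: b; exact: window_near.
Unshelve. all: by end_near. Qed.

(** Equal windows have their ones at the same positions. Position 0 forces [t = 0] because [t <= j].
    Position [i.+1] gives [j <= i], and [j < i] would put a one at [j.+1], strictly between the two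
    ones of 1 0^i 1. *)
Lemma window_count_periodic i j t : (t <= j)%N ->
  window_count i (periodic_orbit j t) = ((t == 0%N) && (i == j))%:Z.
Proof.
move=> tj; congr ((nat_of_bool _)%:Z); apply/eqP/andP.
  move=> /eq_in_map e.
  have {}e k : (k < i.+2)%N -> (j.+1 %| k + t)%N = (i.+1 %| k)%N.
    move=> ki; have := e k; rewrite mem_iota add0n => /(_ ki).
    by rewrite !set_valE /= /periodic_point addr0 => -[].
  have t0 : t = 0%N.
    have := e 0%N isT; rewrite add0n dvdn0; case: t tj {e} => // t tj.
    by rewrite gtnNdvd.
  split; first by rewrite t0.
  have := e i.+1 (ltnSn _); rewrite t0 addn0 dvdnn => /(dvdn_leq (ltn0Sn i)).
  rewrite ltnS leq_eqVlt => /predU1P[->//|ji].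
  have := e j.+1; rewrite t0 addn0 dvdnn => /(_ _)/esym.
  rewrite gtnNdvd // => /(_ _); lia.
by case=> /eqP -> /eqP ->.
Qed.

Lemma window_count_sum i j :
  \sum_(0 <= t < j.+1) window_count i (periodic_orbit j t) = (i == j)%:Z.
Proof.
rewrite big_nat_recl // window_count_periodic // big_nat big1 ?addr0 // => t tj.
by rewrite window_count_periodic.
Qed.

Unset Implicit Arguments.
Set Strict Implicit.
Set Printing Implicit Defensive.

Theorem mainTheorem2 (R : realType) :
  exists (A : finType) (S : mixed_system A),
    forall (G : zmodType) (k : nat) (n : 'I_k -> nat),
      finitely_generated G -> (forall i, (0 < n i)%N) ->
      ~ isomorphic (cech_H1 (tiling_space R S))
                   (G * direct_sum (fun i => zinv (n i)))%type.
Proof.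
exists (option bool : finType), universal_system => G k n fgG _ [phi [psi phiK _]].
have [N dependent] := zinv_sum_dependent n fgG.
have [h h_free] := @orbit_sum_independent R _ universal_system N
  (fun i => window_count i) (fun j => periodic_orbit j)
  (fun j => (j : nat).+1) (fun i => window_count_locally_constant i)
  (fun j => periodic_orbit_shift j) (fun j => periodic_orbit_period j)
  (fun i j => window_count_sum i j).
have [c [[i /eqP ci] sum0]] := dependent (fun i => phi (h i)).
(* Injectivity of [phi] carries the relation between the images back to the classes [h i]. *)
apply/ci/h_free/(can_inj phiK); rewrite raddf0 raddf_sum -[RHS]sum0.
by apply: eq_bigr => j _; rewrite raddfMz.
Qed.
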